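(* Let $(\alpha_t,\sigma_t)$ be an interpolant schedule with $\gamma_t=\dot\alpha_t\sigma_t-\alpha_t\dot\sigma_t$, and define $$\lambda_t=-\frac{\gamma_t}{\alpha_t}=\frac{\alpha_t\dot\sigma_t-\dot\alpha_t\sigma_t}{\alpha_t}.$$ Suppose that (a) $\alpha_t=s_{\mathrm{E}}(t)$ and $\sigma_t=s_{\mathrm{E}}(t)\,\sigma_{\mathrm{E}}(t)$, where $s_{\mathrm{E}},\sigma_{\mathrm{E}}$ are the coefficients of an EDM diffusion process; (b) the velocity is expressed through the score by the score–velocity conversion $\mathbf{s}(\mathbf{x},t)=\dfrac{\alpha_t\mathbf{v}(\mathbf{x},t)-\dot\alpha_t\mathbf{x}}{\sigma_t\gamma_t}$; and (c) the diffusion coefficient is $w_t=2\lambda_t\sigma_t$. Then the FlowSGS prior step reduces to the PnP-DM prior step. That is, the FlowSGS reverse-time SDE $$\mathrm{d}\mathbf{x}_t=\left[\mathbf{v}(\mathbf{x}_t,t)-\tfrac12 w_t\,\mathbf{s}(\mathbf{x}_t,t)\right]\mathrm{d}t+\sqrt{w_t}\,\mathrm{d}\bar{\mathbf{w}}_t$$ coincides (same drift and same diffusion coefficient) with the PnP-DM reverse-time SDE $$\mathrm{d}\mathbf{x}_t=\left[\frac{\dot s_{\mathrm{E}}(t)}{s_{\mathrm{E}}(t)}\mathbf{x}_t-2s_{\mathrm{E}}(t)^2\dot\sigma_{\mathrm{E}}(t)\sigma_{\mathrm{E}}(t)\nabla_{\mathbf{x}_t}\log p\!\left(\frac{\mathbf{x}_t}{s_{\mathrm{E}}(t)};\sigma_{\mathrm{E}}(t)\right)\right]\mathrm{d}t+s_{\mathrm{E}}(t)\sqrt{2\dot\sigma_{\mathrm{E}}(t)\sigma_{\mathrm{E}}(t)}\,\mathrm{d}\bar{\mathbf{w}}_t,$$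 and the FlowSGS timestep conversion and initialization, namely starting at the time $t^*$ with $\sigma_{t^*}/\alpha_{t^*}=\rho_k$ from $\mathbf{x}_{t^*}=\alpha_{t^*}\mathbf{z}^{k+1}$, coincide with those of PnP-DM, namely starting at the time $t^*$ with $\sigma_{\mathrm{E}}(t^* )=\rho_k$ from $\mathbf{x}_{t^*}=s_{\mathrm{E}}(t^* )\mathbf{z}^{k+1}$.
   Context: An interpolant schedule is a pair of smooth functions $(\alpha_t,\sigma_t)$ on $[0,1]$ such that $\alpha_t^2+\sigma_t^2>0$ for all $t$, $\alpha_0=\sigma_1=1$ and $\alpha_1=\sigma_0=0$; it is assumed that $\gamma_t=\dot\alpha_t\sigma_t-\alpha_t\dot\sigma_t<0$, and all formulas are considered at times where $\alpha_t>0$ and $\sigma_t>0$. The interpolant process is $\mathbf{x}_t=\alpha_t\mathbf{x}_0+\sigma_t\boldsymbol{\epsilon}$ in $\mathbb{R}^n$, where $\mathbf{x}_0$ follows the data distribution and $\boldsymbol{\epsilon}\sim\mathcal{N}(0,\mathbf{I})$ is independent of $\mathbf{x}_0$; $p_t$ is the density of $\mathbf{x}_t$, $\mathbf{v}(\mathbf{x},t)=\mathbb{E}[\dot{\mathbf{x}}_t\mid\mathbf{x}_t=\mathbf{x}]$ is the velocity field and $\mathbf{s}(\mathbf{x},t)=\nabla_{\mathbf{x}}\log p_t(\mathbf{x})$ is the score. The function $w_t\ge0$ is a diffusion coefficient chosen at sampling time and $\bar{\mathbf{w}}_t$ is a reverse-time Wiener process. The EDM diffusion process used by PnP-DM is $\mathbf{x}_t=s_{\mathrm{E}}(t)\bigl(\mathbf{x}_0+\sigma_{\mathrm{E}}(t)\boldsymbol{\epsilon}\bigr)$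 with the same $\mathbf{x}_0$ and $\boldsymbol{\epsilon}$, and $p(\cdot\,;\sigma)$ denotes the density of $\mathbf{x}_0+\sigma\boldsymbol{\epsilon}$. FlowSGS and PnP-DM are two split-Gibbs posterior samplers. In iteration $k$, with coupling parameter $\rho_k>0$ and the output $\mathbf{z}^{k+1}\in\mathbb{R}^n$ of the likelihood step, the prior step of each method solves its reverse-time SDE (displayed in the claim) backward in time from the starting time $t^*$ and starting point described in the claim. *)

(* Defs.v *)
From HB Require Import structures.
From mathcomp Require Import all_boot all_order all_algebra.
From mathcomp Require Import all_classical all_reals all_analysis.

Set Implicit Arguments.
Unset Strict Implicit.
Unset Printing Implicit Defensive.
Import Order.TTheory GRing.Theory Num.Theory.
Import numFieldNormedType.Exports.

Local Open Scope ring_scope.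
Local Open Scope classical_set_scope.

(* R^n is 'rV[R]_n, with the sigma-algebra generated by the coordinates (the
   Borel sigma-algebra). *)
Definition measure_row_display : measure_display.
Proof. exact: default_measure_display. Qed.

Section measurable_row.
Context {R : realType} {n : nat}.

Let coors : 'I_n -> 'rV[R]_n -> R := fun i x => x ord0 i.

Let row_set0 : g_sigma_preimage coors set0.
Proof. exact: sigma_algebra0. Qed.

Let row_setC A : g_sigma_preimage coors A -> g_sigma_preimage coors (~` A).
Proof. exact: sigma_algebraC. Qed.

Let row_bigcup (F : _^nat) : (forall i, g_sigma_preimage coors (F i)) ->
  g_sigma_preimage coors (\bigcup_i (F i)).
Proof. exact: sigma_algebra_bigcup. Qed.

HB.instance Definition _ := @isMeasurable.Build measure_row_display
  'rV[R]_n (g_sigma_preimage coors) row_set0 row_setC row_bigcup.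

End measurable_row.

Lemma measurable_coor (R : realType) n (i : 'I_n) :
  measurable_fun [set: 'rV[R]_n] (fun x : 'rV[R]_n => x ord0 i).
Proof.
move=> _ Y mY; rewrite setTI; apply: sub_sigma_algebra => /=.
rewrite -bigcup_seq/=; exists i => /=; first by rewrite mem_index_enum.
by exists Y => //; rewrite setTI.
Qed.

Lemma measurable_fun_rowP (R : realType) n d (T : measurableType d)
    (f : T -> 'rV[R]_n) :
  measurable_fun [set: T] f <->
  forall i, measurable_fun [set: T] (fun x => f x ord0 i).
Proof.
split=> [mf i|mf].
  exact: (measurableT_comp (measurable_coor i) mf).
apply: (@iffRL _ (g_sigma_preimage (fun i x => f x ord0 i) `<=` measurable)).
  apply: (@iff_trans _ (preimage_set_system [set: T] f
      (g_sigma_preimage (fun i (x : 'rV[R]_n) => x ord0 i)) `<=` measurable)).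
    split=> [mf' _ [/= C preC <-]|prefS]; first exact: mf'.
    by move=> _ A mA; apply: prefS; exists A.
  by rewrite -g_sigma_preimage_comp.
apply: smallest_sub; first exact: sigma_algebra_measurable.
case: n => [|n] in f mf *; first by rewrite big_ord0.
rewrite -bigcup_mkord_ord; apply: bigcup_sub => i Ii.
by move=> A [B mB <-]; exact: mf.
Qed.

Section lebesgue_row.
Context {R : realType}.

Definition row_cons n (z : R * 'rV[R]_n) : 'rV[R]_n.+1 :=
  \row_i oapp (fun j => z.2 ord0 j) z.1 (unlift ord0 i).

Definition row_uncons n (x : 'rV[R]_n.+1) : R * 'rV[R]_n :=
  (x ord0 ord0, \row_j x ord0 (lift ord0 j)).

Lemma row_consK n : cancel (@row_cons n) (@row_uncons n).
Proof.
case=> a x; congr pair; first by rewrite mxE unlift_none.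
by apply/rowP => j; rewrite !mxE liftK.
Qed.

Lemma measurable_row_cons n : measurable_fun setT (@row_cons n).
Proof.
apply/measurable_fun_rowP => i; rewrite /row_cons.
under eq_fun do rewrite mxE.
case: (unlift ord0 i) => [j|] /=; last exact: measurable_fst.
exact: (measurableT_comp (measurable_coor j) measurable_snd).
Qed.

Lemma measurable_row_uncons n : measurable_fun setT (@row_uncons n).
Proof.
apply/measurable_fun_pair; first exact: measurable_coor.
apply/measurable_fun_rowP => j; under eq_fun do rewrite mxE.
exact: measurable_coor.
Qed.

Section cons.
Context n (m : {sigma_finite_measure set 'rV[R]_n -> \bar R}).

Definition lebesgue_cons : set 'rV[R]_n.+1 -> \bar R :=
  pushforward (@lebesgue_measure R \x m)%E (@row_cons n).

Let lebesgue_cons_measure : {measure set 'rV[R]_n.+1 -> \bar R} :=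
  measure_function_pushforward__canonical__measure_function_Measure
    (@lebesgue_measure R \x m)%E (@measurable_row_cons n).

Let lebesgue_cons0 : lebesgue_cons set0 = 0%E.
Proof. exact: (measure0 lebesgue_cons_measure). Qed.

Let lebesgue_cons_ge0 A : (0 <= lebesgue_cons A)%E.
Proof. exact: (measure_ge0 lebesgue_cons_measure). Qed.

Let lebesgue_cons_sigma_additive : semi_sigma_additive lebesgue_cons.
Proof. exact: (@measure_semi_sigma_additive _ _ _ lebesgue_cons_measure). Qed.

HB.instance Definition _ := isMeasure.Build _ _ _ lebesgue_cons
  lebesgue_cons0 lebesgue_cons_ge0 lebesgue_cons_sigma_additive.

Let lebesgue_cons_sigma_finite : sigma_finite setT lebesgue_cons.
Proof.
have /sigma_finiteP[F [FT ndF Foo]] := sigma_finiteT (@lebesgue_measure R).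
have /sigma_finiteP[G [GT ndG Goo]] := sigma_finiteT m.
exists (fun k => @row_uncons n @^-1` (F k `*` G k)).
  rewrite -preimage_bigcup (_ : \bigcup_k _ = setT) ?preimage_setT//.
  rewrite -setXTT FT GT predeqE => -[x y]; split => [[k _ [/= ? ?]]|].
    by split; exists k.
  move=> [/= [k _ Fkx] [l _ Gly]]; exists (maxn k l) => //; split.
  - by move: x Fkx; exact/subsetPset/ndF/leq_maxl.
  - by move: y Gly; exact/subsetPset/ndG/leq_maxr.
move=> k; have [mF Fk] := Foo k; have [mG Gk] := Goo k.
have mFG : measurable (F k `*` G k) by exact: measurableX.
split.
  by rewrite -[X in measurable X]setTI; exact: measurable_row_uncons.
rewrite /lebesgue_cons /pushforward -comp_preimage.
rewrite (_ : _ \o _ = id); last by apply/funext => z /=; rewrite row_consK.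
by rewrite preimage_id product_measure1E// lte_mul_pinfty// ge0_fin_numE.
Qed.

HB.instance Definition _ := Measure_isSigmaFinite.Build _ _ _ lebesgue_cons
  lebesgue_cons_sigma_finite.

End cons.

(* Lebesgue measure on R^n, as the n-fold product of the one on R. *)
Fixpoint lebesgue_row n : {sigma_finite_measure set 'rV[R]_n -> \bar R} :=
  if n is k.+1 then lebesgue_cons (lebesgue_row k)
  else dirac (0 : 'rV[R]_0).

End lebesgue_row.

Section probability.
Context {R : realType} {n : nat} {d : measure_display}
  {Omega : measurableType d} (P : probability Omega R).
Implicit Types (X Y : Omega -> 'rV[R]_n) (p : 'rV[R]_n -> R).

Definition is_density X p : Prop :=
  [/\ measurable_fun setT p, forall x, 0 <= p x &
    forall A : set 'rV[R]_n, measurable A ->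
      P (X @^-1` A) = (\int[lebesgue_row n]_(x in A) (p x)%:E)%E].

(* A density is only unique almost everywhere; the score of a law is computed
   from its continuous positive density, which is unique. *)
Definition is_regular_density X p : Prop :=
  [/\ is_density X p, continuous p & forall x, 0 < p x].

Definition std_normal_pdf (x : 'rV[R]_n) : R :=
  \prod_(i < n) normal_pdf 0 1 (x ord0 i).

Definition independent_RV X Y : Prop :=
  forall A B : set 'rV[R]_n, measurable A -> measurable B ->
    P (X @^-1` A `&` Y @^-1` B) = (P (X @^-1` A) * P (Y @^-1` B))%E.

(* v is a version of x |-> E[Y | X = x]. *)
Definition is_cond_expectation Y X (v : 'rV[R]_n -> 'rV[R]_n) : Prop :=
  measurable_fun setT v /\
  forall i : 'I_n,
    P.-integrable setT (fun omega => (Y omega ord0 i)%:E) /\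
    forall A : set 'rV[R]_n, measurable A ->
      (\int[P]_(omega in X @^-1` A) (Y omega ord0 i)%:E =
       \int[P]_(omega in X @^-1` A) (v (X omega) ord0 i)%:E)%E.

End probability.

Section schedule.
Context {R : realType}.
Implicit Types (alpha sigma : R -> R) (t : R).

(* Smoothness up to the boundary of [0, 1], as the restriction of a smooth
   function on the real line. *)
Definition smooth01 (f : R -> R) : Prop :=
  exists2 g : R -> R, (forall k t, derivable (derive1n k g) t 1) &
    forall t, 0 <= t <= 1 -> f t = g t.

Definition gamma alpha sigma t : R :=
  derive1 alpha t * sigma t - alpha t * derive1 sigma t.

Definition lambda alpha sigma t : R := - (gamma alpha sigma t / alpha t).

(* The sign of gamma is only required inside the interval: the values of the
   schedule outside [0, 1] are irrelevant, whereas the two-sided derivatives at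
   the endpoints depend on them. *)
Record interpolant_schedule alpha sigma : Prop := InterpolantSchedule {
  schedule_smooth_alpha : smooth01 alpha ;
  schedule_smooth_sigma : smooth01 sigma ;
  schedule_nondegenerate :
    forall t, 0 <= t <= 1 -> 0 < alpha t ^+ 2 + sigma t ^+ 2 ;
  schedule_start : alpha 0 = 1 /\ sigma 0 = 0 ;
  schedule_end : alpha 1 = 0 /\ sigma 1 = 1 ;
  schedule_gamma : forall t, 0 < t < 1 -> gamma alpha sigma t < 0 }.

(* The times at which the formulas are considered; they all lie in the open
   interval, since alpha vanishes at 1 and sigma vanishes at 0. *)
Definition admissible alpha sigma t : Prop :=
  [/\ 0 <= t <= 1, 0 < alpha t & 0 < sigma t].

End schedule.

Section process.
Context {R : realType} {n : nat} {Omega : Type}.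
Variables (x0 eps : Omega -> 'rV[R]_n).

Definition interpolant (alpha sigma : R -> R) (t : R) (omega : Omega) :
    'rV[R]_n :=
  alpha t *: x0 omega + sigma t *: eps omega.

Definition interpolant_dot (alpha sigma : R -> R) (t : R) (omega : Omega) :
    'rV[R]_n :=
  derive1 (fun u => interpolant alpha sigma u omega) t.

Definition noised (s : R) (omega : Omega) : 'rV[R]_n :=
  x0 omega + s *: eps omega.

End process.

Section prior_steps.
Context {R : realType} {n : nat}.
Implicit Types (p : R -> 'rV[R]_n -> R) (v s : 'rV[R]_n -> R -> 'rV[R]_n).

Definition gradient (f : 'rV[R]_n -> R) (x : 'rV[R]_n) : 'rV[R]_n :=
  \row_i 'D_(delta_mx ord0 i) f x.

Definition score p (x : 'rV[R]_n) (t : R) : 'rV[R]_n :=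
  gradient (fun y => ln (p t y)) x.

(* A prior step runs backward in time the equation
     dx_t = drift(x_t, t) dt + diffusion(t) dw_t
   driven by a reverse-time Wiener process. It starts at a time t* with
   start_time rho t*, from the point start_point t* z, where rho is the coupling
   parameter and z the output of the likelihood step. *)
Record prior_step : Type := PriorStep {
  drift : 'rV[R]_n -> R -> 'rV[R]_n ;
  diffusion : R -> R ;
  start_time : R -> R -> Prop ;
  start_point : R -> 'rV[R]_n -> 'rV[R]_n }.

Definition flowsgs_prior_step (alpha sigma : R -> R) v s (w : R -> R) :
    prior_step := {|
  drift x t := v x t - (2^-1 * w t) *: s x t ;
  diffusion t := Num.sqrt (w t) ;
  start_time rho t := sigma t / alpha t = rho ;
  start_point t z := alpha t *: z |}.

(* q s is the density of the data noised at level s. *)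
Definition pnpdm_prior_step (sE sigmaE : R -> R) (q : R -> 'rV[R]_n -> R) :
    prior_step := {|
  drift x t := (derive1 sE t / sE t) *: x
    - (2 * sE t ^+ 2 * derive1 sigmaE t * sigmaE t) *:
        gradient (fun y => ln (q (sigmaE t) ((sE t)^-1 *: y))) x ;
  diffusion t := sE t * Num.sqrt (2 * derive1 sigmaE t * sigmaE t) ;
  start_time rho t := sigmaE t = rho ;
  start_point t z := sE t *: z |}.

End prior_steps.

(* Main.v *)
(* Near an admissible time, [sE = alpha] and [sigmaE = sigma / alpha], whose
   derivative is [- gamma / alpha ^+ 2]. The interpolant is then [alpha t] times
   the data noised at level [sigmaE t], so that by uniqueness of continuous
   densities [p t x = alpha t ^- n * q (sigmaE t) (x / alpha t)]: the logarithms
   of both sides differ by a constant and the two scores agree. With the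
   velocity expressed by the score, the drifts and diffusion coefficients are
   then equal by field arithmetic. *)
Require Import Defs.
From HB Require Import structures.
From mathcomp Require Import all_boot all_order all_algebra.
From mathcomp Require Import all_classical all_reals all_analysis.
From mathcomp Require Import measurable_realfun ring.

Set Implicit Arguments.
Unset Strict Implicit.
Unset Printing Implicit Defensive.
Import Order.TTheory GRing.Theory Num.Theory.
Import numFieldNormedType.Exports.

Local Open Scope ring_scope.
Local Open Scope classical_set_scope.

Section densities.
Context {R : realType}.
Local Open Scope ereal_scope.

(** Rows carry the sup distance, so balls are cubes. For [n = 0] the right-hand side is everything,
    whereas a ball of nonpositive radius is empty. *)
Lemma row_ballE n (x : 'rV[R]_n) (r : R) : (0 < r)%R ->
  ball x r = [set y | forall i, ball (x ord0 i) r (y ord0 i)].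
Proof.
move=> r0; apply/seteqP; split=> y /=.
  by case=> _ h i; exact: h.
by move=> h; split=> // i j; rewrite !ord1; exact: h.
Qed.

Lemma measurable_row_ball n (x : 'rV[R]_n) (r : R) : measurable (ball x r).
Proof.
have [r0|r0] := ltP 0%R r; last first.
  rewrite (_ : ball x r = set0); first exact: measurable0.
  by apply/seteqP; split=> y // [+ _]; rewrite ltNge r0.
rewrite row_ballE// (_ : [set _ | _] =
    \bigcap_(i in [set: 'I_n]) [set y | ball (x ord0 i) r (y ord0 i)]); last first.
  by apply/seteqP; split=> y /= h i; [move=> _; exact: h|exact: h].
apply: fin_bigcap_measurable => [|i _]; first exact: finite_finset.
rewrite -[X in measurable X]setTI.
by apply: measurable_coor => //; exact: measurable_ball.
Qed.

Lemma lebesgue_row_ball n (x : 'rV[R]_n) (r : R) : (0 < r)%R ->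
  lebesgue_row n (ball x r) = ((2 * r) ^+ n)%:E.
Proof.
move=> r0; elim: n x => [|n IHn] x.
  by rewrite /= row_ballE// diracE mem_set// => -[].
rewrite /= /lebesgue_cons /pushforward.
(* Through [row_cons], a cube is an interval of length [2 * r] times a cube of one dimension
   less. *)
rewrite (_ : _ @^-1` _ = ball (row_uncons x).1 r `*` ball (row_uncons x).2 r).
  rewrite product_measure1E; [|exact: measurable_ball|exact: measurable_row_ball].
  rewrite [X in X * _](lebesgue_measure_ball _ (ltW r0)) [X in _ * X]IHn.
  by rewrite -EFinM exprS mulr_natl.
rewrite !row_ballE//; apply/seteqP; split=> -[a y] /=.
  move=> h; split; first by have := h ord0; rewrite mxE unlift_none.
  by move=> i; have := h (lift ord0 i); rewrite !mxE liftK.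
by move=> [ha hy] i; rewrite mxE; case: unliftP => [j ->|->]//=;
  have := hy j; rewrite !mxE.
Qed.

Section density_limit.
Context {n : nat} {d : measure_display} {Omega : measurableType d}
  (P : probability Omega R).
Implicit Types X Y : Omega -> 'rV[R]_n.

(* A continuous density is recovered from the law by shrinking balls, hence
   determined by it pointwise. *)
Lemma cvg_density X (p : 'rV[R]_n -> R) (x : 'rV[R]_n) :
  is_density P X p -> {for x, continuous p} ->
  (fine (P (X @^-1` ball x r)) / (2 * r) ^+ n)%R @[r --> 0^'+] --> p x.
Proof.
move=> [mp p0 Pp] cp; apply/cvgrPdist_le => e e0.
have /nbhs_ballP[b /= b0 pb] :
    \forall y \near x, (`|p x - p y| <= e)%R by exact: cvgr_dist_le cp _ e0.
near=> r.
have r0 : (0 < r)%R by near: r; exact: nbhs_right_gt.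
have rb : (r < b)%R by near: r; exact: nbhs_right_lt.
have V0 : (0 < (2 * r) ^+ n)%R by rewrite exprn_gt0// mulr_gt0.
have mB := measurable_row_ball x r.
have pe y : ball x r y -> (p x - e <= p y <= p x + e)%R.
  by move=> /(le_ball (ltW rb))/pb; rewrite ler_distlC.
have mpB : measurable_fun (ball x r) (EFin \o p).
  by apply/measurable_EFinP; exact: measurable_funTS.
have cst_int (c : R) : \int[lebesgue_row n]_(y in ball x r) c%:E =
    (c * (2 * r) ^+ n)%:E.
  by rewrite integral_cst// [X in _ * X]lebesgue_row_ball// EFinM.
have upper : P (X @^-1` ball x r) <= ((p x + e) * (2 * r) ^+ n)%:E.
  rewrite Pp// -cst_int; apply: ge0_le_integral => //.
  - by move=> y _; rewrite lee_fin.
  - by move=> y /pe /andP[_]; rewrite lee_fin.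
(* Truncating at 0 keeps the constant integrand nonnegative, as monotonicity of the integral is
   applied to nonnegative functions. *)
have lower : (Num.max 0 (p x - e) * (2 * r) ^+ n)%:E <= P (X @^-1` ball x r).
  rewrite Pp// -cst_int; apply: ge0_le_integral => //.
  - by move=> y _; rewrite lee_fin le_max lexx.
  - by move=> y /pe /andP[? _]; rewrite lee_fin ge_max p0.
have fin : P (X @^-1` ball x r) \is a fin_num.
  rewrite fin_real//; apply/andP; split.
    by rewrite (lt_le_trans _ lower)// ltNyr.
  by rewrite (le_lt_trans upper)// ltry.
move: upper lower; rewrite -(fineK fin) !lee_fin => upper lower.
rewrite ler_distlC ler_pdivlMr// ler_pdivrMr// upper andbT.
by rewrite (le_trans _ lower)// ler_pM2r// le_max lexx orbT.
Unshelve. all: by end_near. Qed.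

Lemma cvg_at_right0_pmul (a : R) : (0 < a)%R ->
  (a * r)%R @[r --> 0^'+] --> 0^'+.
Proof.
move=> a0 A [e /= e0 eA]; exists (e / a)%R => /=; first by rewrite divr_gt0.
move=> r /=; rewrite sub0r normrN => re r0; apply: eA; last by rewrite mulr_gt0.
by rewrite /= sub0r normrN normrM (gtr0_norm a0) mulrC -ltr_pdivlMr.
Qed.

(** The events that [X] lies in the ball of radius [a * r] at [x] and that [Y] lies in the ball of
    radius [r] at [a^-1 *: x] are the same, and the volumes of the two balls differ by the factor
    [a ^+ n]. Dividing and letting [r] tend to 0 compares the densities at every point. *)
Lemma regular_density_scale X Y (p q : 'rV[R]_n -> R) (a : R) : (0 < a)%R ->
  is_regular_density P X p -> is_regular_density P Y q ->
  (forall omega, X omega = a *: Y omega)%R ->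
  forall x, p x = ((a ^+ n)^-1 * q (a^-1 *: x))%R.
Proof.
move=> a0 [dp cp _] [dq cq _] XY x.
have px := cvg_comp _ _ (cvg_at_right0_pmul a0) (cvg_density dp (cp x)).
have qx := cvg_density dq (cq (a^-1 *: x)%R).
apply: (cvg_unique _ px) => //.
apply: (cvg_trans _ (cvgM (cvg_cst (a ^- n)%R) qx)).
apply: near_eq_cvg; near=> r => /=.
have r0 : (0 < r)%R by near: r; exact: nbhs_right_gt.
rewrite (_ : X @^-1` _ = Y @^-1` ball (a^-1 *: x)%R r).
  by rewrite mulrCA [(2 * (a * r))%R]mulrCA (exprMn _ a) invfM.
apply/seteqP; rewrite !row_ballE ?mulr_gt0//.
have ballE (b c : R) : ball (a^-1 * b)%R r c = ball b (a * r)%R (a * c)%R.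
  rewrite /ball /= -[in RHS](mulVKf (lt0r_neq0 a0) b) -mulrBr normrM.
  by rewrite gtr0_norm// ltr_pM2l.
by split=> omega /= h i; have := h i; rewrite XY !mxE ballE.
Unshelve. all: by end_near. Qed.

End density_limit.
End densities.

(** The constant cancels in each difference quotient, so the limits agree as terms, whether or not
    they exist. *)
Lemma gradient_addl (R : realType) n (c : R) (f : 'rV[R]_n -> R) x :
  gradient (fun y => c + f y) x = gradient f x.
Proof.
apply/rowP => i; rewrite !mxE /derive; congr (lim _).
by under eq_fun do rewrite /= (addrC c) addrKA.
Qed.

Lemma smooth01_derivable (R : realType) (f : R -> R) t :
  smooth01 f -> 0 < t < 1 -> derivable f t 1.
Proof.
(* At an interior time [f] agrees with its smooth extension [g] on a whole neighbourhood; the case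
   [k = 0] of [dg] concerns [g] itself. *)
move=> [g dg fg] t01; apply: (@near_eq_derivable _ _ _ g); last exact: (dg 0%N).
near=> u; rewrite fg//.
have /andP[u0 u1] : u \in `]0, 1[%R by near: u; apply: near_in_itvoo; rewrite in_itv.
by rewrite !ltW.
Unshelve. all: by end_near. Qed.

Section schedule.
Context {R : realType} (alpha sigma : R -> R) (t : R).
Hypotheses (sched : interpolant_schedule alpha sigma)
  (adm : admissible alpha sigma t).

Lemma admissible_itv : 0 < t < 1.
Proof.
case: adm => /andP[t0 t1] at0 st0; rewrite !lt_neqAle t0 t1 !andbT.
have [_ s0] := schedule_start sched; have [a1 _] := schedule_end sched.
apply/andP; split.
  by apply: contraTneq st0 => <-; rewrite s0 ltxx.
by apply: contraTneq at0 => ->; rewrite a1 ltxx.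
Qed.

(** Openness of admissibility is what allows identities known only at admissible times to be
    differentiated. *)
Lemma near_admissible : \forall u \near t, admissible alpha sigma u.
Proof.
case: adm => _ at0 st0.
have cnt f : smooth01 f -> {for t, continuous f}.
  move=> sf; apply/differentiable_continuous/derivable1_diffP.
  exact: smooth01_derivable sf admissible_itv.
have ca := cnt _ (schedule_smooth_alpha sched).
have cs := cnt _ (schedule_smooth_sigma sched).
near=> u.
have /andP[u0 u1] : u \in `]0, 1[%R.
  by near: u; apply: near_in_itvoo; rewrite in_itv/= admissible_itv.
split; first by rewrite !ltW.
- by near: u; exact: (cvgr_gt _ ca).
- by near: u; exact: (cvgr_gt _ cs).
Unshelve. all: by end_near. Qed.

End schedule.

Theorem corollary1 (R : realType) (n : nat) (d : measure_display)
    (Omega : measurableType d) (P : probability Omega R)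
    (x0 eps : {RV P >-> 'rV[R]_n})
    (alpha sigma : R -> R)
    (p : R -> 'rV[R]_n -> R) (v : 'rV[R]_n -> R -> 'rV[R]_n) (w : R -> R)
    (sE sigmaE : R -> R) (q : R -> 'rV[R]_n -> R) :
  interpolant_schedule alpha sigma ->
  (* eps ~ N(0, I) *)
  is_density P eps std_normal_pdf ->
  independent_RV P x0 eps ->
  (forall t, admissible alpha sigma t ->
    is_regular_density P (interpolant x0 eps alpha sigma t) (p t)) ->
  (forall t, admissible alpha sigma t ->
    is_cond_expectation P (interpolant_dot x0 eps alpha sigma t)
      (interpolant x0 eps alpha sigma t) (v ^~ t)) ->
  (forall s : R, 0 < s -> is_regular_density P (noised x0 eps s) (q s)) ->
  (forall t, admissible alpha sigma t -> 0 <= w t) ->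
  (* (a) *)
  (forall t, admissible alpha sigma t ->
    alpha t = sE t /\ sigma t = sE t * sigmaE t) ->
  (* (b) *)
  (forall t x, admissible alpha sigma t ->
    score p x t = (sigma t * gamma alpha sigma t)^-1 *:
                    (alpha t *: v x t - derive1 alpha t *: x)) ->
  (* (c) *)
  (forall t, admissible alpha sigma t ->
    w t = 2 * lambda alpha sigma t * sigma t) ->
  let flowsgs := flowsgs_prior_step alpha sigma v (score p) w in
  let pnpdm := pnpdm_prior_step sE sigmaE q in
  forall t, admissible alpha sigma t ->
    [/\ forall x, drift flowsgs x t = drift pnpdm x t,
        diffusion flowsgs t = diffusion pnpdm t,
        forall rho : R, 0 < rho ->
          (start_time flowsgs rho t <-> start_time pnpdm rho t) &
        forall z, start_point flowsgs t z = start_point pnpdm t z].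
Proof.
move=> sched _ _ dp _ dq _ a_def score_def w_def flowsgs pnpdm t adm.
have [_ at0 st0] := adm.
have t01 := admissible_itv sched adm.
have [a_t s_t] := a_def _ adm.
have sigmaE_t : sigmaE t = sigma t / alpha t.
  by rewrite s_t -a_t mulrC mulKf// gt_eqF.
have near_adm := near_admissible sched adm.
have sE' : derive1 sE t = derive1 alpha t.
  rewrite !derive1E; apply: near_eq_derive.
  by near=> u; have [] := a_def u; [near: u; exact: near_adm|].
have sigmaE' : derive1 sigmaE t = - gamma alpha sigma t / alpha t ^+ 2.
  have da := smooth01_derivable (schedule_smooth_alpha sched) t01.
  have ds := smooth01_derivable (schedule_smooth_sigma sched) t01.
  have -> : derive1 sigmaE t = 'D_1 (sigma * (fun u => (alpha u)^-1)) t.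
    rewrite derive1E; apply: near_eq_derive; near=> u.
    have adm_u : admissible alpha sigma u by near: u; exact: near_adm.
    have [_ au0 _] := adm_u; have [a_u s_u] := a_def _ adm_u.
    rewrite -[RHS]/(sigma u / alpha u).
    by rewrite s_u -a_u mulrC mulKf// gt_eqF.
  rewrite deriveM//; last by apply: derivableV => //; rewrite gt_eqF.
  rewrite deriveV ?gt_eqF// /gamma !derive1E /GRing.scale /=.
  by field; rewrite gt_eqF.
have gamma0 := schedule_gamma sched t01.
have score_q x : score p x t =
    gradient (fun y => ln (q (sigmaE t) ((sE t)^-1 *: y))) x.
  have sigmaE0 : 0 < sigmaE t by rewrite sigmaE_t divr_gt0.
  (* The added constant is the logarithm of the Jacobian factor [alpha t ^- n]; with it the two
     log-densities are equal as functions. *)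
  rewrite -a_t -(gradient_addl (ln (alpha t ^+ n)^-1)) /score.
  congr (gradient _ x); apply/funext => y.
  rewrite -lnM ?posrE ?invr_gt0 ?exprn_gt0//; last by case: (dq _ sigmaE0).
  congr ln; apply: (regular_density_scale at0 (dp _ adm) (dq _ sigmaE0)).
  by move=> omega; rewrite /interpolant /noised scalerDr scalerA s_t a_t.
split=> /=.
- move=> x; rewrite -score_q sE' sigmaE' sigmaE_t -a_t w_def// /lambda.
  (* This is (b) solved for the velocity, possible since [gamma] is nonzero at [t]. *)
  have -> : v x t = (derive1 alpha t / alpha t) *: x
      + (sigma t * gamma alpha sigma t / alpha t) *: score p x t.
    rewrite score_def// scalerA; apply/rowP => i; rewrite !mxE.
    by field; rewrite (lt_eqF gamma0) !gt_eqF.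
  (* The terms in [x] agree. By (c), [w / 2 = - sigma * gamma / alpha], so both coefficients of the
     score are [2 * sigma * gamma / alpha]. *)
  rewrite -addrA -scalerBl -[in RHS]scaleNr; congr (_ + _ *: _).
  by field; rewrite gt_eqF.
- rewrite sigmaE' sigmaE_t -a_t w_def// /lambda.
  (* The prefactor [alpha t] enters the root as its square; both radicands are then
     [- 2 * gamma * sigma / alpha]. *)
  rewrite -[X in _ = X * _](gtr0_norm at0) -sqrtr_sqr -sqrtrM ?sqr_ge0//.
  by congr Num.sqrt; field; rewrite gt_eqF.
- by move=> rho _; rewrite sigmaE_t.
- by move=> z; rewrite a_t.
Unshelve. all: by end_near. Qed.
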